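(* Let $\mathcal{F}$ be the filtration associated to a covering polyhedron $\mathcal{Q}$ and let $V(\mathcal{Q})$ be the vertex set of $\mathcal{Q}$. If $\alpha(\mathcal{Q})=\min\{|v|\colon v\in V(\mathcal{Q})\}$, then $\alpha(\mathcal{Q})=\widehat{\alpha}(\mathcal{F})$.
   Context: $S=K[t_1,\ldots,t_s]$ is a polynomial ring over a field $K$, $\mathbb{N}=\{0,1,\ldots\}$, $t^a=t_1^{a_1}\cdots t_s^{a_s}$ for $a\in\mathbb{N}^s$; vector inequalities are componentwise and $1$ also denotes $(1,\ldots,1)$. For $v=(v_1,\ldots,v_s)$, $|v|=\sum_{i=1}^sv_i$. A covering polyhedron is a polyhedron $\mathcal{Q}=\mathcal{Q}(C)=\{x\in\mathbb{R}^s\mid x\geq 0;\ xC\geq 1\}$ ($x$ a row vector), where $C$ is an $s\times m$ matrix with non-negative rational entries and non-zero columns. Its associated filtration $\mathcal{F}=\{I_n\}_{n=0}^\infty$ is $I_0=S$ and, for $n\geq 1$, $I_n$ the ideal generated by all monomials $t^a$, $a\in\mathbb{N}^s$, with $a/n\in\mathcal{Q}$. For $n\geq 1$, $\alpha_{\mathcal{F}}(n)$ is the least degree of a monomial in $I_n$, and the Waldschmidt constant of $\mathcal{F}$ is $\widehat{\alpha}(\mathcal{F})=\lim_{n\to\infty}\alpha_{\mathcal{F}}(n)/n$ (this limit exists and equals $\inf_{n\geq 1}\alpha_{\mathcal{F}}(n)/n$). *)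

(* Defs.v *)
(* R^s is 'rV[R]_s and K[t_1,...,t_s] is [mpoly s K] from multinomials, whose
   notations clash with those of MathComp-Analysis and are not imported. *)
From HB Require Import structures.
From mathcomp Require Import all_boot all_order all_algebra.
From mathcomp Require Import all_classical all_reals all_analysis.
From mathcomp Require Export -(notations) mpoly.

Set Implicit Arguments.
Unset Strict Implicit.
Unset Printing Implicit Defensive.

Import Order.TTheory GRing.Theory Num.Theory.
Import numFieldNormedType.Exports.

Local Open Scope classical_set_scope.
Local Open Scope ring_scope.

Definition is_min (disp : Order.disp_t) (T : porderType disp) (A : set T)
  (x : T) : Prop := A x /\ forall y, A y -> (x <= y)%O.

(* Takes the value [x0] when [A] has no least element. *)
Definition minimum (disp : Order.disp_t) (T : porderType disp) (x0 : T)
  (A : set T) : T := xget x0 (is_min A).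

Definition covering_polyhedron (R : realType) (s m : nat) (C : 'M[rat]_(s, m)) :
  set 'rV[R]_s :=
  [set x : 'rV[R]_s | (forall i, 0 <= x 0 i) /\
    (forall j, 1 <= (x *m map_mx ratr C) 0 j)].
Arguments covering_polyhedron R {s m} C _.

(* Faces are cut out by valid inequalities <a, x> >= b.  Allowing a = 0 makes
   Q itself a face, so that a polyhedron reduced to a point has a vertex. *)
Definition is_face (R : realType) (s : nat) (Q F : set 'rV[R]_s) : Prop :=
  exists (a : 'rV[R]_s) (b : R),
    (forall x, Q x -> b <= \sum_i a 0 i * x 0 i) /\
    F = Q `&` [set x : 'rV[R]_s | \sum_i a 0 i * x 0 i = b].

Definition vertices (R : realType) (s : nat) (Q : set 'rV[R]_s) :
  set 'rV[R]_s := [set v | is_face Q [set v]].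

Definition coord_sum (R : realType) (s : nat) (v : 'rV[R]_s) : R :=
  \sum_i v 0 i.

Definition alpha_polyhedron (R : realType) (s : nat) (Q : set 'rV[R]_s) : R :=
  minimum 0 (@coord_sum R s @` vertices Q).

(* The ideals of ring_quotient are proper, which excludes I_0 = S; hence this
   plain definition. *)
Definition is_ideal (A : comNzRingType) (I : set A) : Prop :=
  [/\ I 0, (forall p q, I p -> I q -> I (p + q))
    & (forall p q, I q -> I (p * q))].

Definition generated_ideal (A : comNzRingType) (G : set A) : set A :=
  smallest (@is_ideal A) G.

Definition filtration (R : realType) (K : fieldType) (s : nat)
  (Q : set 'rV[R]_s) (n : nat) : set (mpoly s K) :=
  if n is 0%N then setT
  else generated_ideal
         [set mpolyX K a | a in [set a : multinom s |
            Q (\row_i ((a i)%:R / n%:R))]].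
Arguments filtration {R} K {s} Q n _.

Definition alpha_filtration (K : fieldType) (s : nat)
  (I : nat -> set (mpoly s K)) (n : nat) : nat :=
  minimum 0%N [set mdeg a | a in [set a : multinom s | I n (mpolyX K a)]].

(* The term of index 0 is a division by zero, irrelevant for the limit. *)
Definition waldschmidt_seq (R : realType) (K : fieldType) (s : nat)
  (I : nat -> set (mpoly s K)) : R^nat :=
  fun n => (alpha_filtration I n)%:R / n%:R.

Definition waldschmidt (R : realType) (K : fieldType) (s : nat)
  (I : nat -> set (mpoly s K)) : R := limn (waldschmidt_seq R I).

Arguments waldschmidt_seq R {K s} I n.
Arguments waldschmidt R {K s} I.

(* Main.v *)
Require Import Defs.
From mathcomp Require Import all_boot all_order all_algebra.
From mathcomp Require Import all_classical all_reals all_analysis.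

(** The theorem says that an integer program, suitably rescaled, has the same
    value as its linear relaxation.

    On the polyhedral side, the minimum of |x| over Q is attained at a vertex
    ([covering_polyhedron_vertex_min]), so alpha(Q) is the minimum of |x| over
    the whole of Q.  This is the fundamental theorem of linear programming
    ([exists_vertex_min]), and applies because the recession cone of Q lies in
    the nonnegative orthant, on which |x| vanishes only at the origin.  It is
    proved without compactness: from any point of the polyhedron one reaches,
    without increasing the objective and by making one more constraint tight
    at each step, a point determined by its tight constraints; there are
    finitely many of these, and each is a vertex.

    On the algebraic side, since C is nonnegative, Q is closed under increasing
    coordinates.  Hence the exponents a with a/n in Q already form a
    semigroup ideal, t^a belongs to I_n exactly when a/n lies in Q
    ([monomial_ideal_mem]), and alpha_F(n)/n is the minimum of |x| over the
    points of Q with coordinates in (1/n)N.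

    Let v be a vertex of Q minimizing |x|.  Then |v| <= alpha_F(n)/n, and
    rounding the coordinates of n v up gives alpha_F(n)/n <= |v| + s/n
    ([waldschmidt_seq_bounds]).  Letting n tend to infinity gives both the
    existence of the limit and its value |v| = alpha(Q). *)

Import Order.TTheory GRing.Theory Num.Theory.
Import numFieldNormedType.Exports.

Local Open Scope classical_set_scope.
Local Open Scope ring_scope.

(** * Least elements *)

Lemma minimumP {disp : Order.disp_t} {T : porderType disp} (x0 : T) (A : set T) :
  (exists x, is_min A x) -> is_min A (minimum x0 A).
Proof. exact: xgetPex. Qed.

Lemma is_min_unique {disp : Order.disp_t} {T : porderType disp} {A : set T}
  {x y : T} : is_min A x -> is_min A y -> x = y.
Proof.
by move=> [Ax xA] [Ay yA]; apply/eqP; rewrite eq_le xA // yA.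
Qed.

Lemma nat_is_min_ex (A : set nat) : A !=set0 -> exists n, is_min A n.
Proof.
move=> [n An].
have exA : exists n, `[< A n >] by exists n; apply/asboolP.
case: (ex_minnP exA) => k /asboolP Ak kA; exists k; split=> // l Al.
by rewrite leEnat; apply/kA/asboolP.
Qed.

(** * Minimizing a linear form at a vertex of a polyhedron *)

Definition polyhedron {R : realType} {s p : nat} (A : 'M[R]_(s, p))
  (b : 'rV[R]_p) : set 'rV[R]_s :=
  [set x | forall k, b 0 k <= (x *m A) 0 k].

Definition active {R : realType} {s p : nat} (A : 'M[R]_(s, p)) (b : 'rV[R]_p)
  (x : 'rV[R]_s) : {set 'I_p} := finset (fun k => (x *m A) 0 k == b 0 k).

(** The constraints active at [x] have only the zero direction in common, that
    is, their normals (columns of [A]) span the space: these are the basic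
    feasible solutions of linear programming when [x] is in the polyhedron. *)
Definition basic {R : realType} {s p : nat} (A : 'M[R]_(s, p)) (b : 'rV[R]_p)
  (x : 'rV[R]_s) : Prop :=
  forall d : 'rV[R]_s,
    (forall k, k \in active A b x -> (d *m A) 0 k = 0) -> d = 0.

(** A basic point is the only solution of the equations of its active
    constraints; this bounds the number of basic points of a polyhedron by the
    number of sets of constraints, and isolates each of them as a face. *)
Lemma basic_active_inj {R : realType} {s p : nat} {A : 'M[R]_(s, p)}
  {b : 'rV[R]_p} {x y : 'rV[R]_s} :
  basic A b x -> active A b x \subset active A b y -> y = x.
Proof.
move=> bx /fintype.subsetP xy; apply/eqP; rewrite -subr_eq0; apply/eqP/bx => k kx.
have := xy k kx; move: kx; rewrite !inE mulmxBl => /eqP xk /eqP yk.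
by rewrite !mxE in xk yk *; rewrite xk yk subrr.
Qed.

(** Adding up the constraints active at [v] gives a valid inequality, which is
    tight only where all of them are, hence only at [v]. *)
Lemma basic_vertex {R : realType} {s p : nat} (A : 'M[R]_(s, p))
  (b : 'rV[R]_p) (v : 'rV[R]_s) :
  polyhedron A b v -> basic A b v -> vertices (polyhedron A b) v.
Proof.
move=> Pv bv; pose V := active A b v.
pose a : 'rV[R]_s := \row_i \sum_(k in V) A i k.
have aE (x : 'rV[R]_s) : \sum_i a 0 i * x 0 i = \sum_(k in V) (x *m A) 0 k.
  under [RHS]eq_bigr do rewrite mxE.
  rewrite exchange_big /=; apply: eq_bigr => i _.
  by rewrite mxE mulrC mulr_sumr.
exists a, (\sum_(k in V) b 0 k); split=> [x Px|]; first by rewrite aE ler_sum.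
apply/seteqP; split=> [x ->|x [Px /= /eqP]].
  by split=> //=; rewrite aE; apply: eq_bigr => k; rewrite inE => /eqP.
rewrite aE -subr_eq0 -sumrB psumr_eq0; last by move=> k _; rewrite subr_ge0.
move=> /allP x0; apply: (basic_active_inj bv); apply/fintype.subsetP => k kV.
have := x0 k (mem_index_enum _); rewrite -/V in kV *; rewrite kV /= subr_eq0.
by rewrite inE.
Qed.

(** If [x] is not basic, the constraints active at [x] remain tight along some
    line through [x].  Follow it in the direction that does not increase the
    objective: [w_gt0] says that the objective is positive on the nonzero part
    of the recession cone, so this direction leaves the polyhedron, and the
    first constraint met becomes active in addition to the previous ones. *)
Lemma active_step {R : realType} {s p : nat} {A : 'M[R]_(s, p)}
  {b : 'rV[R]_p} {w : 'cV[R]_s}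
  (w_gt0 : forall d : 'rV[R]_s,
    (forall k, 0 <= (d *m A) 0 k) -> (d *m w) 0 0 <= 0 -> d = 0)
  {x : 'rV[R]_s} :
  polyhedron A b x -> ~ basic A b x ->
  exists y : 'rV[R]_s, [/\ polyhedron A b y, (y *m w) 0 0 <= (x *m w) 0 0
    & active A b x \proper active A b y].
Proof.
move=> Px nbx.
have [d [dx d0 dw]] : exists d : 'rV[R]_s,
    [/\ forall k, k \in active A b x -> (d *m A) 0 k = 0, d != 0
      & (d *m w) 0 0 <= 0].
  have [d /not_implyP[dx /eqP d0]] := (existsNP _).2 nbx.
  have [dw|dw] := leP ((d *m w) 0 0) 0; first by exists d.
  exists (- d); split; last by rewrite mulNmx mxE oppr_le0 ltW.
    by move=> k kx; rewrite mulNmx mxE dx // oppr0.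
  by rewrite oppr_eq0.
have [k0 dk0] : exists k, (d *m A) 0 k < 0.
  apply: contrapT => /forallNP dA; case/eqP: d0; apply: w_gt0 => // k.
  by rewrite leNgt; apply/negP/dA.
(* [t k] is the step length at which the constraint [k] becomes tight. *)
pose t k := ((x *m A) 0 k - b 0 k) / - (d *m A) 0 k.
have [k1 dk1 tk1] := @arg_minP _ _ _ k0 (fun k => (d *m A) 0 k < 0) t dk0.
have t1_ge0 : 0 <= t k1 by rewrite divr_ge0 ?subr_ge0 ?oppr_ge0 ?(ltW dk1).
pose y := x + t k1 *: d.
have yE k : (y *m A) 0 k = (x *m A) 0 k + t k1 * (d *m A) 0 k.
  by rewrite mulmxDl -scalemxAl mxE; congr (_ + _); rewrite mxE.
exists y; split.
- move=> k; rewrite yE; have [dk|dk] := ltP ((d *m A) 0 k) 0.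
    have := tk1 k dk; rewrite [t k]/t ler_pdivlMr ?oppr_gt0 // mulrN.
    by rewrite lerBrDr addrC -lerBrDr opprK addrC.
  by apply: (le_trans (Px k)); rewrite lerDl mulr_ge0.
- have -> : (y *m w) 0 0 = (x *m w) 0 0 + t k1 * (d *m w) 0 0.
    by rewrite mulmxDl -scalemxAl mxE; congr (_ + _); rewrite mxE.
  by rewrite gerDl mulr_ge0_le0.
- rewrite properE; apply/andP; split.
    apply/fintype.subsetP => k kx; have := kx.
    by rewrite !inE yE dx // mulr0 addr0.
  apply/fintype.subsetPn; exists k1.
    rewrite inE yE /t invrN mulrN mulNr divfK ?(lt_eqF dk1) //.
    by rewrite subKr.
  by apply/negP => /dx dk; rewrite dk ltxx in dk1.
Qed.

Lemma exists_basic_le {R : realType} {s p : nat} {A : 'M[R]_(s, p)}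
  {b : 'rV[R]_p} {w : 'cV[R]_s}
  (w_gt0 : forall d : 'rV[R]_s,
    (forall k, 0 <= (d *m A) 0 k) -> (d *m w) 0 0 <= 0 -> d = 0)
  (x : 'rV[R]_s) :
  polyhedron A b x ->
  exists y : 'rV[R]_s, [/\ polyhedron A b y, basic A b y
    & (y *m w) 0 0 <= (x *m w) 0 0].
Proof.
have [n] := ubnP #|~: active A b x|.
elim: n x => // n IHn x xn Px.
have [bx|nbx] := pselect (basic A b x); first by exists x.
have [y [Py yx xy]] := active_step w_gt0 Px nbx.
have [|z [Pz bz zy]] := IHn y _ Py.
  rewrite ltnS in xn; apply: leq_trans xn.
  by rewrite proper_card // properC.
by exists z; split=> //; apply: le_trans yx.
Qed.

(** Below every point of the polyhedron there is a basic one, so it is enough to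
    compare basic points; as these are determined by their active sets, a
    least value is found by minimizing over the finite type of sets of
    constraints. *)
Lemma exists_vertex_min {R : realType} {s p : nat} (A : 'M[R]_(s, p))
  (b : 'rV[R]_p) (w : 'cV[R]_s)
  (w_gt0 : forall d : 'rV[R]_s,
    (forall k, 0 <= (d *m A) 0 k) -> (d *m w) 0 0 <= 0 -> d = 0) :
  polyhedron A b !=set0 ->
  exists2 v, vertices (polyhedron A b) v
    & forall x, polyhedron A b x -> (v *m w) 0 0 <= (x *m w) 0 0.
Proof.
move=> [x0 /(exists_basic_le w_gt0)[y0 [Py0 by0 _]]].
pose B (S : {set 'I_p}) : set 'rV[R]_s :=
  [set v | [/\ polyhedron A b v, basic A b v & active A b v = S]].
pose g S := xget 0 (B S).
have gE v : polyhedron A b v -> basic A b v ->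
    B (active A b v) !=set0 /\ g (active A b v) = v.
  move=> Pv bv; have Bv : B (active A b v) !=set0 by exists v.
  split=> //; apply: (basic_active_inj bv).
  by have [_ _ ->] := xgetPex 0 Bv.
have [By0 _] := gE _ Py0 by0.
have [S /asboolP BS Smin] := @arg_minP _ _ _ (active A b y0)
  (fun S => `[< B S !=set0 >]) (fun S => (g S *m w) 0 0) (asboolT By0).
have [Pv bv _] := xgetPex 0 BS.
exists (g S); first exact: basic_vertex.
move=> x /(exists_basic_le w_gt0)[y [Py b_y yx]]; apply: le_trans yx.
have [By gy] := gE y Py b_y.
by rewrite -[in leRHS]gy; apply: Smin; apply/asboolP.
Qed.

Lemma vertices_sub {R : realType} {s : nat} (Q : set 'rV[R]_s) :
  vertices Q `<=` Q.
Proof. by move=> v [a [b [_ /seteqP[/(_ v erefl)[]]]]]. Qed.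

(** * Covering polyhedra *)

Lemma covering_polyhedronE {R : realType} {s m : nat} (C : 'M[rat]_(s, m)) :
  covering_polyhedron R C =
  polyhedron (row_mx 1%:M (map_mx ratr C)) (row_mx 0 (const_mx 1)).
Proof.
apply/seteqP; split=> x; rewrite /polyhedron /= mul_mx_row mulmx1.
  move=> [x0 xC] k; have [j ->|j ->] := split_ordP k.
    by rewrite !row_mxEl mxE.
  by rewrite !row_mxEr mxE.
move=> xk; split=> [i|j].
  by have := xk (lshift m i); rewrite !row_mxEl mxE.
by have := xk (rshift s j); rewrite !row_mxEr mxE.
Qed.

Lemma covering_polyhedron_up {R : realType} {s m : nat} {C : 'M[rat]_(s, m)}
  (C_ge0 : forall i j, 0 <= C i j) (x y : 'rV[R]_s) :
  covering_polyhedron R C x -> (forall i, x 0 i <= y 0 i) ->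
  covering_polyhedron R C y.
Proof.
move=> [x0 xC] xy; split=> [i|j]; first exact: le_trans (xy i).
apply: (le_trans (xC j)); rewrite !mxE; apply: ler_sum => i _.
by rewrite ler_wpM2r // mxE ler0q.
Qed.

(** As the columns of C are nonnegative and nonzero, they have positive sums, so
    a vector with all coordinates large enough satisfies every constraint. *)
Lemma covering_polyhedron_neq0 (R : realType) {s m : nat}
  {C : 'M[rat]_(s, m)} (C_ge0 : forall i j, 0 <= C i j)
  (C_col_neq0 : forall j, col j C != 0) :
  covering_polyhedron R C !=set0.
Proof.
pose S j : R := \sum_i ratr (C i j).
have S_gt0 j : 0 < S j.
  rewrite lt_def sumr_ge0 ?andbT; last by move=> i _; rewrite ler0q.
  apply: contra (C_col_neq0 j); rewrite psumr_eq0; last first.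
    by move=> i _; rewrite ler0q.
  move=> /allP C0; apply/eqP/colP => i; rewrite !mxE.
  by apply/eqP; have := C0 i (mem_index_enum _); rewrite fmorph_eq0.
(* Summing the bounds 1 / S j gives a common upper bound for them. *)
exists (const_mx (\sum_j (S j)^-1)); split=> [i|j].
  by rewrite mxE sumr_ge0 // => j _; rewrite invr_ge0 ltW.
rewrite mxE; under eq_bigr do rewrite !mxE.
rewrite -mulr_sumr -/(S j) -[leLHS](mulVf (lt0r_neq0 (S_gt0 j))).
rewrite ler_pM2r // (bigD1 j) //= lerDl sumr_ge0 // => k _.
by rewrite invr_ge0 ltW.
Qed.

(** A direction of the recession cone has nonnegative coordinates, hence is zero
    as soon as their sum is nonpositive. *)
Lemma covering_polyhedron_vertex_min (R : realType) {s m : nat}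
  {C : 'M[rat]_(s, m)} (C_ge0 : forall i j, 0 <= C i j)
  (C_col_neq0 : forall j, col j C != 0) :
  exists2 v, vertices (covering_polyhedron R C) v
    & forall x, covering_polyhedron R C x -> coord_sum v <= coord_sum x.
Proof.
have sumE (x : 'rV[R]_s) : (x *m (const_mx 1 : 'cV[R]_s)) 0 0 = coord_sum x.
  by rewrite mxE; apply: eq_bigr => i _; rewrite mxE mulr1.
have Q0 := covering_polyhedron_neq0 R C_ge0 C_col_neq0.
rewrite covering_polyhedronE in Q0 *.
have [|v Vv vmin] := exists_vertex_min _ _ (const_mx 1) _ Q0; last first.
  by exists v => // x Px; rewrite -!sumE vmin.
move=> d dA; rewrite sumE => d_le0.
have d_ge0 i : 0 <= d 0 i.
  by have := dA (lshift m i); rewrite mul_mx_row mulmx1 row_mxEl.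
have : coord_sum d == 0 by rewrite eq_le d_le0 sumr_ge0.
rewrite psumr_eq0 // => /allP d0; apply/rowP => i; rewrite mxE.
by apply/eqP/(d0 i)/mem_index_enum.
Qed.

(** * Monomial ideals and the Waldschmidt constant *)

(** The polynomials whose monomials all have exponents in [G] form an ideal,
    since every monomial of a product is a product of monomials; it contains
    the generators, hence the ideal that they generate. *)
Lemma monomial_ideal_mem (K : fieldType) {s : nat} (G : set (multinom s)) :
  (forall a c, G a -> G (mnm_add a c)) ->
  forall a, generated_ideal [set mpolyX K a | a in G] (mpolyX K a) <-> G a.
Proof.
move=> Gup a; split=> [|Ga]; last by apply: sub_gen_smallest; exists a.
pose J : set (mpoly s K) := [set p | forall c, c \in msupp p -> G c].
have JI : is_ideal J.
  split=> [c|p q Jp Jq c|p q Jq c]; first by rewrite msupp0.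
    by move=> /msuppD_le; rewrite mem_cat => /orP[/Jp|/Jq].
  move=> /msuppM_le/allpairsP[[c1 c2] [_ /Jq Gc2 ->]].
  by rewrite addmC; apply: Gup.
have GJ : [set mpolyX K a | a in G] `<=` J.
  by move=> _ [c Gc <-] c'; rewrite msuppX inE => /eqP ->.
move=> /(_ J (conj JI GJ)); apply; rewrite msuppX inE; exact: eqxx.
Qed.

(** The exponent is [n * x], with each coordinate rounded to an integer; the
    rounding adds at most 1 to each of the [s] coordinates. *)
Lemma round_up_exponent {R : realType} {s n : nat} (x : 'rV[R]_s) :
  (forall i, 0 <= x 0 i) -> (0 < n)%N ->
  exists2 a : multinom s, (forall i, x 0 i <= (a i)%:R / n%:R)
    & (mdeg a)%:R / n%:R <= coord_sum x + s%:R / n%:R.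
Proof.
move=> x0 n0; have n0R : 0 < n%:R :> R by rewrite ltr0n.
pose a : multinom s :=
  Multinom [tuple (Num.truncn (n%:R * x 0 i)).+1 | i < s].
have aE i : a i = (Num.truncn (n%:R * x 0 i)).+1 by rewrite mnmE.
exists a => [i|].
  by rewrite ler_pdivlMr // mulrC aE ltW // truncnS_gt.
rewrite ler_pdivrMr // mulrDl divfK ?gt_eqF // mdegE natr_sum.
rewrite [coord_sum x * _]mulrC mulr_sumr.
rewrite -[X in _ + X%:R]card_ord -sumr_const -big_split /=.
apply: ler_sum => i _; rewrite aE -natr1 lerD2r truncn_le.
by rewrite mulr_ge0 // ltW.
Qed.

(** [Q] being closed under increasing coordinates, the exponents of the
    generators of I_n are those of all its monomials.  The least degree exists
    because rounding up a point of [Q] produces such an exponent. *)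
Lemma alpha_filtration_is_min {R : realType} (K : fieldType) {s n : nat}
  {Q : set 'rV[R]_s} :
  (forall x y : 'rV[R]_s, Q x -> (forall i, x 0 i <= y 0 i) -> Q y) ->
  (forall x, Q x -> forall i, 0 <= x 0 i) -> Q !=set0 -> (0 < n)%N ->
  is_min [set mdeg a | a in [set a : multinom s |
    Q (\row_i ((a i)%:R / n%:R))]] (alpha_filtration (filtration K Q) n).
Proof.
case: n => // n Qup Qge0 [x Qx] n0.
rewrite /alpha_filtration /=.
set G := [set a : multinom s | Q _].
have Gup a c : G a -> G (mnm_add a c).
  move=> Ga; apply: Qup Ga _ => i; rewrite !mxE.
  by rewrite ler_wpM2r ?invr_ge0 // ler_nat mnmDE leq_addr.
have -> : [set a : multinom s | generated_ideal [set mpolyX K a | a in G]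
    (mpolyX K a)] = G.
  by apply/seteqP; split=> a /(monomial_ideal_mem K G Gup).
apply/minimumP/nat_is_min_ex.
have [a xa _] := round_up_exponent x (Qge0 x Qx) n0.
by exists (mdeg a), a => //; apply: Qup Qx _ => i; rewrite mxE.
Qed.

(** Scaling an exponent of I_n by 1/n gives a point of [Q], whence the lower
    bound; the upper bound comes from the exponent obtained by rounding up
    [n * v]. *)
Lemma waldschmidt_seq_bounds {R : realType} (K : fieldType) {s n : nat}
  {Q : set 'rV[R]_s} {v : 'rV[R]_s} :
  (forall x y : 'rV[R]_s, Q x -> (forall i, x 0 i <= y 0 i) -> Q y) ->
  (forall x, Q x -> forall i, 0 <= x 0 i) ->
  Q v -> (forall x, Q x -> coord_sum v <= coord_sum x) -> (0 < n)%N ->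
  coord_sum v <= waldschmidt_seq R (filtration K Q) n
    <= coord_sum v + s%:R / n%:R.
Proof.
move=> Qup Qge0 Qv vmin n0; rewrite /waldschmidt_seq.
have [|[a Qa <-] amin] := alpha_filtration_is_min K Qup Qge0 _ n0.
  by exists v.
apply/andP; split.
  apply: (le_trans (vmin _ Qa)); rewrite /coord_sum mdegE natr_sum mulr_suml.
  by apply: ler_sum => i _; rewrite mxE.
have [c vc cdeg] := round_up_exponent v (Qge0 v Qv) n0.
apply: le_trans cdeg; rewrite ler_wpM2r ?invr_ge0 // ler_nat -leEnat.
by apply: amin; exists c => //; apply: Qup Qv _ => i; rewrite mxE.
Qed.

Theorem corollary3p5 (R : realType) (K : fieldType) (s m : nat)
  (C : 'M[rat]_(s, m))
  (C_ge0 : forall i j, 0 <= C i j)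
  (C_col_neq0 : forall j, col j C != 0) :
  let Q := covering_polyhedron R C in
  let I := filtration K Q in
  [/\ is_min (@coord_sum R s @` vertices Q) (alpha_polyhedron Q),
      cvgn (waldschmidt_seq R I)
    & alpha_polyhedron Q = waldschmidt R I].
Proof.
move=> Q I.
have [v Vv vmin] := covering_polyhedron_vertex_min R C_ge0 C_col_neq0.
have vertex_min : is_min (@coord_sum R s @` vertices Q) (coord_sum v).
  by split=> [|_ [u /vertices_sub Qu <-]]; [exists v | exact: vmin].
have alpha_min : is_min (@coord_sum R s @` vertices Q) (alpha_polyhedron Q).
  by apply: minimumP; exists (coord_sum v).
have cvgI : waldschmidt_seq R I @ \oo --> alpha_polyhedron Q.
  rewrite (is_min_unique alpha_min vertex_min).
  apply: (@squeeze_cvgr _ _ _ _ (fun=> coord_sum v)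
    (fun n => coord_sum v + s%:R / n%:R)).
  - near=> n; apply: waldschmidt_seq_bounds => //.
    + exact: covering_polyhedron_up.
    + by move=> x [].
    + exact: vertices_sub.
    + by near: n; exists 1%N.
  - exact: cvg_cst.
  - rewrite -[X in _ --> X]addr0; apply: cvgD; first exact: cvg_cst.
    rewrite -[X in _ --> X](mulr0 s%:R); apply: cvgMr.
    by rewrite -(cvg_shiftS); exact: cvg_harmonic.
split=> //; first by apply/cvg_ex; exists (alpha_polyhedron Q).
by apply/esym/cvg_lim.
Unshelve. all: by end_near. Qed.
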